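(* Let $m_1,m_2,n\in\mathbb{N}$, $m=m_1+m_2$, $j=\mathrm{diag}\{I_{m_1},-I_{m_2}\}$, and let $\mathcal{I}$ be either $\mathbb{N}_0$ or $\{k\in\mathbb{N}_0:\ 0\le k<N\}$ for some $N\in\mathbb{N}$. Put $\mathcal{K}=\mathbb{N}_0$ in the first case and $\mathcal{K}=\{0,1,\dots,N\}$ in the second case. Let an initial Dirac system $$y_{k+1}(z)=\Big(I_m+\frac{\mathrm{i}}{z}C_k\Big)y_k(z),\qquad C_k=U_k^*jU_k\quad(k\in\mathcal{I}),$$ with $m\times m$ unitary matrices $U_k$, be given. Let $\alpha$ and $S_0=S_0^*$ be $n\times n$ matrices and $\Lambda_0$ an $n\times m$ matrix such that $$\alpha S_0-S_0\alpha^*=\mathrm{i}\Lambda_0\Lambda_0^*,\qquad \det\alpha\neq0,$$ let $\Lambda_k,S_k$ $(k\in\mathcal{K})$ be defined by the recursions $$\Lambda_{k+1}=\Lambda_k+\mathrm{i}\alpha^{-1}\Lambda_kC_k,\qquad S_{k+1}=S_k+\alpha^{-1}S_k(\alpha^* )^{-1}+\alpha^{-1}\Lambda_kC_k\Lambda_k^*(\alpha^* )^{-1}\quad(k\in\mathcal{I}),$$ and assume that $\det S_k\ne0$ for all $k\in\mathcal{K}$. Define $$\widetilde C_k=C_k+\Lambda_k^*S_k^{-1}\Lambda_k-\Lambda_{k+1}^*S_{k+1}^{-1}\Lambda_{k+1}\quad(k\in\mathcal{I}).$$ Let $w(k,z)$ and $\widetilde w(k,z)$ be the fundamental solutions of the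 initial system and of the transformed system $\widetilde y_{k+1}(z)=\big(I_m+\frac{\mathrm{i}}{z}\widetilde C_k\big)\widetilde y_k(z)$ $(k\in\mathcal{I})$, respectively, normalized by $w(0,z)=\widetilde w(0,z)=I_m$. Then $$\widetilde w(k,z)=w_\alpha(k,-z)\,w(k,z)\,w_\alpha(0,-z)^{-1}\qquad(k\in\mathcal{K}),$$ where $$w_\alpha(k,z)=I_m-\mathrm{i}\Lambda_k^*S_k^{-1}(\alpha-zI_n)^{-1}\Lambda_k.$$ The equality is understood as an equality of rational matrix functions of $z\in\mathbb{C}$; that is, it holds for all $z\ne0$ such that $-z$ is not an eigenvalue of $\alpha$ and $w_\alpha(0,-z)$ is invertible.
   Context: All matrices have complex entries; $\mathbb{N}_0=\{0\}\cup\mathbb{N}$; $I_m$ is the $m\times m$ identity matrix; $^*$ denotes conjugate transpose. The fundamental solution of a system $y_{k+1}(z)=(I_m+\frac{\mathrm{i}}{z}C_k)y_k(z)$ $(k\in\mathcal{I})$ is the $m\times m$ matrix solution $w(k,z)$ with $w(0,z)=I_m$, i.e. $w(k+1,z)=(I_m+\frac{\mathrm{i}}{z}C_k)w(k,z)$. *)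

(* Defs.v *)
From mathcomp Require Import all_boot all_order all_algebra.
From mathcomp Require Import reals complex.

Set Implicit Arguments.
Unset Strict Implicit.
Unset Printing Implicit Defensive.

Import Order.TTheory GRing.Theory Num.Theory.
Local Open Scope ring_scope.
Local Open Scope sesquilinear_scope.

(* [None] encodes the half-line (system indices and solution indices both range
   over all of nat); [Some N] encodes the finite interval, where the system
   index satisfies 0 <= k < N and the solution index 0 <= k <= N.
   Sequences are total functions on nat; only their values at these indices
   are constrained. *)
Definition valid_length (L : option nat) : bool :=
  if L is Some N then (0 < N)%N else true.

Definition system_index (L : option nat) (k : nat) : bool :=
  if L is Some N then (k < N)%N else true.

Definition solution_index (L : option nat) (k : nat) : bool :=
  if L is Some N then (k <= N)%N else true.

Section Dirac.
Variable K : numClosedFieldType.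

Definition signature_mx (m1 m2 : nat) : 'M[K]_(m1 + m2) :=
  block_mx 1%:M 0 0 (- 1%:M).

Definition dirac_potential (m1 m2 : nat) (U : nat -> 'M[K]_(m1 + m2))
    (k : nat) : 'M[K]_(m1 + m2) :=
  (U k)^t* *m signature_mx m1 m2 *m U k.

Fixpoint fundamental_solution (m : nat) (C : nat -> 'M[K]_m) (k : nat) (z : K)
    : 'M[K]_m :=
  if k is k'.+1
  then (1%:M + ('i / z) *: C k') *m fundamental_solution C k' z
  else 1%:M.

Section Darboux.
Variables (m n : nat) (C : nat -> 'M[K]_m).
Variables (alpha S0 : 'M[K]_n) (Lambda0 : 'M[K]_(n, m)).

Fixpoint Lambda (k : nat) : 'M[K]_(n, m) :=
  if k is k'.+1
  then Lambda k' + 'i *: (invmx alpha *m Lambda k' *m C k')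
  else Lambda0.

Fixpoint S_ (k : nat) : 'M[K]_n :=
  if k is k'.+1
  then S_ k' + invmx alpha *m S_ k' *m invmx (alpha^t*)
       + invmx alpha *m Lambda k' *m C k' *m (Lambda k')^t* *m invmx (alpha^t*)
  else S0.

Definition transformed_potential (k : nat) : 'M[K]_m :=
  C k + (Lambda k)^t* *m invmx (S_ k) *m Lambda k
  - (Lambda k.+1)^t* *m invmx (S_ k.+1) *m Lambda k.+1.

Definition darboux_mx (k : nat) (z : K) : 'M[K]_m :=
  1%:M - 'i *: ((Lambda k)^t* *m invmx (S_ k) *m invmx (alpha - z%:M)
                *m Lambda k).

End Darboux.
End Dirac.

(* Main.v *)
(* Write w' for the Darboux matrix at k+1 and w for the one at k, both at -z.
   The claim telescopes to the one-step intertwining relation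
   (I + i/z tC_k) w = w' (I + i/z C_k). The identity
   alpha S_k - S_k alpha^* = i Lambda_k Lambda_k^* propagates along the
   recursions because C_k^* = C_k and C_k^2 = I. Given it, all dependence on z
   in the one-step relation can be split off, leaving an identity that follows
   from S_{k+1} alpha^* = alpha S_k + alpha^-1 S_k - i Lambda_{k+1} Lambda_k^*. *)
Require Import Defs.
From mathcomp Require Import all_boot all_order all_algebra.
From mathcomp Require Import reals complex ring.

Set Implicit Arguments.
Unset Strict Implicit.
Unset Printing Implicit Defensive.

Import Order.TTheory GRing.Theory Num.Theory.
Local Open Scope ring_scope.
Local Open Scope sesquilinear_scope.

(** * A resolvent formula and entrywise tools *)

(** Multiplying by [A + z%:M], which commutes with [A + invmx A], leaves a relation linear in [A]
    and [invmx A]. *)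
Lemma resolvent_sub_scalar (F : fieldType) (n : nat) (A : 'M[F]_n) (z : F) :
  A \in unitmx -> z != 0 -> A + z%:M \in unitmx ->
  invmx (A + z%:M) *m (1%:M - z^-1 *: invmx A) - z^-1 *: 1%:M
  = - (z^-1 *: ((A + invmx A) *m invmx (A + z%:M))).
Proof.
move=> uA z0 uR; apply: (can_inj (mulKmx uR)).
have cR : (A + z%:M) *m (A + invmx A) = (A + invmx A) *m (A + z%:M).
  rewrite !(mulmxDl, mulmxDr) mulmxV // mulVmx // !mul_scalar_mx.
  by rewrite !mul_mx_scalar addrACA.
rewrite mulmxBr mulKVmx // mulmxN -!scalemxAr mulmxA cR mulmxK // mulmx1.
rewrite -(scalemx1 _ z); apply/matrixP => i j; move: (invmx A) 1%:M => B E.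
by rewrite !mxE; field.
Qed.

Lemma adjmx_mul (K : numClosedFieldType) (m n p : nat)
    (A : 'M[K]_(m, n)) (B : 'M[K]_(n, p)) :
  (A *m B)^t* = B^t* *m A^t*.
Proof. by rewrite trmx_mul map_mxM. Qed.

(* Unlike [mxE], does not unfold the matrix products. *)
Lemma entryE (R : nzRingType) (m n : nat) (i : 'I_m) (j : 'I_n) :
  ((forall A B : 'M[R]_(m, n), ((A + B) i j = A i j + B i j)%R)
   * (forall A : 'M[R]_(m, n), ((- A) i j = - A i j)%R)
   * (forall a (A : 'M[R]_(m, n)), ((a *: A) i j = a * A i j)%R))%type.
Proof. by split; [split=> * |move=> *]; rewrite mxE. Qed.

(** * Propagation of the Lyapunov identity and the one-step intertwining *)

Section DarbouxStep.
Variables (K : numClosedFieldType) (m n : nat) (C : nat -> 'M[K]_m).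
Variables (alpha S0 : 'M[K]_n) (Lambda0 : 'M[K]_(n, m)).
Hypothesis alpha_unit : alpha \in unitmx.

Local Notation Lam := (Lambda C alpha Lambda0).
Local Notation S := (S_ C alpha S0 Lambda0).
Local Notation tC := (transformed_potential C alpha S0 Lambda0).
Local Notation beta := (alpha^t*).

Definition lyapunov_identity (k : nat) : Prop :=
  alpha *m S k - S k *m beta = 'i *: (Lam k *m (Lam k)^t*).

Let sqri : 'i * 'i = -1 :> K.
Proof. by rewrite -expr2 sqrCi. Qed.

Let beta_unit : beta \in unitmx.
Proof. by rewrite map_unitmx unitmx_tr. Qed.

Lemma alpha_LambdaS (k : nat) :
  alpha *m Lam k.+1 = alpha *m Lam k + 'i *: (Lam k *m C k).
Proof. by rewrite /= mulmxDr -scalemxAr -mulmxA mulKVmx. Qed.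

Lemma LambdaS_adj (k : nat) : (C k)^t* = C k ->
  (Lam k.+1)^t* *m beta = (Lam k)^t* *m beta - 'i *: (C k *m (Lam k)^t*).
Proof.
move=> hC; rewrite -adjmx_mul alpha_LambdaS linearD map_mxD /= adjmx_mul.
by rewrite linearZ map_mxZ /= adjmx_mul hC conjCi scaleNr.
Qed.

(** Right multiplication by [beta] clears its inverse from the recursion. The term with [C k] is
    then [- 'i] times the increment of [Lam], times [(Lam k)^t*], and the Lyapunov identity trades
    [S k *m beta] for [alpha *m S k]. *)
Lemma mulmx_SS_adj (k : nat) : lyapunov_identity k ->
  S k.+1 *m beta
  = alpha *m S k + invmx alpha *m S k - 'i *: (Lam k.+1 *m (Lam k)^t*).
Proof.
move=> hS; have {hS}-> : alpha *m S k = S k *m beta + 'i *: (Lam k *m (Lam k)^t*).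
  by rewrite -hS addrC subrK.
rewrite /= !mulmxDl !mulmxKV // -!scalemxAl.
apply/matrixP => i j; rewrite !entryE; ring: sqri.
Qed.

Lemma lyapunov_identityS (k : nat) :
  (C k)^t* = C k -> C k *m C k = 1%:M ->
  lyapunov_identity k -> lyapunov_identity k.+1.
Proof.
move=> hC hCC hS; apply: (can_inj (mulmxK beta_unit)).
have aS : alpha *m S k = S k *m beta + 'i *: (Lam k *m (Lam k)^t*).
  by rewrite -hS addrC subrK.
(* Here [C k *m C k = 1%:M] enters: [C k] disappears from the increment. *)
have LC : Lam k.+1 *m C k = Lam k *m C k + 'i *: (invmx alpha *m Lam k).
  rewrite /= mulmxDl -scalemxAl. by rewrite -(mulmxA _ _ (C k)) hCC mulmx1.
have := mulmx_SS_adj hS; have := LambdaS_adj hC; have := alpha_LambdaS k.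
rewrite /lyapunov_identity; move: (Lam k.+1) (S k.+1) LC => L' S' LC aL Lb Sb.
rewrite mulmxBl -mulmxA Sb -scalemxAl -mulmxA Lb.
have a'S : S k = invmx alpha *m (S k *m beta + 'i *: (Lam k *m (Lam k)^t*)).
  by rewrite -aS mulKmx.
rewrite !(mulmxDl, mulmxDr, mulNmx, mulmxN) mulKVmx //.
(* The bare [S k], left by [alpha *m invmx alpha *m S k], is expanded so that it cancels
   [invmx alpha *m S k *m beta]. *)
rewrite {2}a'S aS -!scalemxAr -!scalemxAl (mulmxA alpha) aL.
rewrite (mulmxA _ (C k)) LC.
rewrite !(mulmxDl, mulmxDr) -!scalemxAl -!scalemxAr !mulmxA.
rewrite aS mulmxDl -scalemxAl.
by apply/matrixP => i j; rewrite !entryE; ring: sqri.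
Qed.

(* The [z]-independent identity behind the Darboux transformation: it cancels
   the coefficient of [invmx (alpha + z%:M) *m Lam k] in [darboux_mxS]. *)
Lemma transformed_potential_intertwine (k : nat) :
  (C k)^t* = C k -> lyapunov_identity k ->
  S k \in unitmx -> S k.+1 \in unitmx ->
  (Lam k.+1)^t* *m invmx (S k.+1) *m (alpha + invmx alpha)
    + 'i *: (tC k *m (Lam k)^t* *m invmx (S k))
  = (Lam k)^t* *m invmx (S k) *m alpha.
Proof.
move=> hC hS uS uS'; have := mulmx_SS_adj hS; have := LambdaS_adj hC.
rewrite /transformed_potential.
move: (Lam k.+1) (S k.+1) uS' => L' S' uS' Lb Sb.
apply: (can_inj (mulmxK uS)).
rewrite mulmxDl -!scalemxAl mulmxKV // -!mulmxA.
(* Read backwards, [mulmx_SS_adj] produces a factor [S'] that cancels the inverse in front of it. *)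
have -> : (alpha + invmx alpha) *m S k = S' *m beta + 'i *: (L' *m (Lam k)^t*).
  by rewrite Sb subrK mulmxDl.
have -> : alpha *m S k = S k *m beta + 'i *: (Lam k *m (Lam k)^t*).
  by rewrite -hS addrC subrK.
rewrite !(mulmxDl, mulmxDr, mulNmx) -!scalemxAr !mulKmx // Lb !mulmxA.
by apply/matrixP => i j; rewrite !entryE; ring: sqri.
Qed.

(** Since [C k] squares to the identity, [Lam k.+1 *m (1%:M + ('i / z) *: C k)] differs from
    [z^-1 *: ((alpha + z%:M) *m Lam k.+1)] only by a multiple of [(alpha + invmx alpha) *m Lam k].
    The resolvent thus acts on [Lam k] alone, as in the Darboux matrix at [k]. *)
Lemma resolvent_LambdaS (k : nat) (z : K) :
  C k *m C k = 1%:M -> z != 0 -> alpha + z%:M \in unitmx ->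
  invmx (alpha + z%:M) *m Lam k.+1 *m (1%:M + ('i / z) *: C k)
  = z^-1 *: Lam k.+1
    - z^-1 *: ((alpha + invmx alpha) *m invmx (alpha + z%:M) *m Lam k).
Proof.
move=> hCC z0 uz; rewrite scalemxAl -mulNmx -resolvent_sub_scalar //.
apply: (can_inj (mulKmx uz)).
rewrite -!mulmxA mulKVmx // mulmxDr -scalemxAr mulmxBl mulmxDr mulmxBr.
rewrite !mulmxA mulmxV // mul1mx /= !(mulmxDl, mulmxDr).
rewrite !(mul_scalar_mx, mulNmx, mulmx1, mul1mx) -!scalemxAr -!scalemxAl.
rewrite mulmx1 mulmxDr -scalemxAr !mulmxA mulmxV // mul1mx.
rewrite -(mulmxA _ (C k) (C k)) hCC mulmx1.
by apply/matrixP => i j; rewrite !entryE; field: sqri.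
Qed.

Lemma darboux_mxS (k : nat) (z : K) :
  (C k)^t* = C k -> C k *m C k = 1%:M -> lyapunov_identity k ->
  S k \in unitmx -> S k.+1 \in unitmx -> z != 0 -> alpha + z%:M \in unitmx ->
  (1%:M + ('i / z) *: tC k) *m darboux_mx C alpha S0 Lambda0 k (- z)
  = darboux_mx C alpha S0 Lambda0 k.+1 (- z) *m (1%:M + ('i / z) *: C k).
Proof.
move=> hC hCC hS uS uS' z0 uz.
have := transformed_potential_intertwine hC hS uS uS'.
have := resolvent_LambdaS hCC z0 uz.
(* Inserting [alpha + z%:M] and its inverse expresses [tC k] through the same
   [invmx (alpha + z%:M) *m Lam k] as the Darboux matrices. *)
have tCE : tC k = C k
  + (Lam k)^t* *m invmx (S k) *m ((alpha + z%:M) *m (invmx (alpha + z%:M) *m Lam k))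
  - (Lam k.+1)^t* *m invmx (S k.+1) *m Lam k.+1.
  by rewrite mulKVmx.
rewrite /darboux_mx (_ : alpha - (- z)%:M = alpha + z%:M); last first.
  by rewrite raddfN opprK.
move: (tC k) (Lam k.+1) (S k.+1) tCE => T L' S' tCE.
rewrite -!mulmxA in tCE * => res twine.
rewrite mulmxBr mulmx1 mulmxBl mul1mx -scalemxAl -!mulmxA res.
move: (invmx (alpha + z%:M) *m Lam k) tCE => RL tCE.
rewrite !mulmxA in tCE twine *.
rewrite -(mulmxA T) in twine.
set P := (Lam k)^t* *m invmx (S k) in twine tCE *.
set P' := L'^t* *m invmx S' in twine tCE *.
have {}twine : P' *m ((alpha + invmx alpha) *m RL)
    = P *m alpha *m RL - 'i *: (T *m P *m RL).
  by rewrite -twine mulmxDl -scalemxAl addrK mulmxA.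
rewrite [in RHS]mulmxBr -!scalemxAr twine mulmxDl mul1mx -scalemxAl mulmxA.
(* Only the bare [T] is expanded; the terms in [T *m P *m RL] cancel as they stand. *)
apply/matrixP => i j; move: (congr1 (fun A : 'M_m => A i j) tCE).
rewrite mulmxDr mul_mx_scalar mulmxDl -scalemxAl !entryE => ->.
by field: sqri.
Qed.

(** Cleared of the inverse at [0], the claim telescopes by [darboux_mxS]. Hypotheses stop at [k],
    which serves the finite interval and the half-line alike. *)
Lemma fundamental_solution_darboux (k : nat) (z : K) :
  (forall i, (i < k)%N -> (C i)^t* = C i /\ C i *m C i = 1%:M) ->
  lyapunov_identity 0 -> (forall i, (i <= k)%N -> S i \in unitmx) ->
  z != 0 -> alpha + z%:M \in unitmx ->
  fundamental_solution tC k z *m darboux_mx C alpha S0 Lambda0 0 (- z)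
  = darboux_mx C alpha S0 Lambda0 k (- z) *m fundamental_solution C k z.
Proof.
move=> hC hS0 uS z0 uz.
have hS i : (i <= k)%N -> lyapunov_identity i.
  elim: i => // i IH ik; have [hCi hCCi] := hC i ik.
  exact: lyapunov_identityS hCi hCCi (IH (ltnW ik)).
suff main i : (i <= k)%N ->
    fundamental_solution tC i z *m darboux_mx C alpha S0 Lambda0 0 (- z)
    = darboux_mx C alpha S0 Lambda0 i (- z) *m fundamental_solution C i z.
  exact: main.
elim: i => [_|i IH ik]; first by rewrite mul1mx mulmx1.
have [hCi hCCi] := hC i ik; have ik' := ltnW ik.
have step := darboux_mxS hCi hCCi (hS i ik') (uS i ik') (uS i.+1 ik) z0 uz.
by rewrite [LHS]/= -mulmxA IH // mulmxA step -mulmxA.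
Qed.

End DarbouxStep.

(** * Dirac potentials are self-adjoint involutions *)

Lemma signature_mx_adj (K : numClosedFieldType) (m1 m2 : nat) :
  (signature_mx K m1 m2)^t* = signature_mx K m1 m2.
Proof.
rewrite /signature_mx -[- 1%:M]scaleN1r scale_scalar_mx mulr1.
rewrite tr_block_mx map_block_mx !trmx0 !map_mx0 !tr_scalar_mx !map_scalar_mx /=.
by rewrite conjCN1 conjC1.
Qed.

Lemma signature_mx_sqr (K : numClosedFieldType) (m1 m2 : nat) :
  signature_mx K m1 m2 *m signature_mx K m1 m2 = 1%:M.
Proof.
rewrite mulmx_block !(mulmx0, mul0mx, mulmx1, mul1mx, addr0, add0r).
by rewrite mulmxN mulmx1 opprK -scalar_mx_block.
Qed.

Lemma dirac_potential_adj (K : numClosedFieldType) (m1 m2 : nat)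
    (U : nat -> 'M[K]_(m1 + m2)) (k : nat) :
  (dirac_potential U k)^t* = dirac_potential U k.
Proof. by rewrite !adjmx_mul trmxCK mulmxA signature_mx_adj. Qed.

Lemma dirac_potential_sqr (K : numClosedFieldType) (m1 m2 : nat)
    (U : nat -> 'M[K]_(m1 + m2)) (k : nat) :
  U k \is unitarymx -> dirac_potential U k *m dirac_potential U k = 1%:M.
Proof.
move=> uU; rewrite /dirac_potential !mulmxA (mulmxtVK _ uU).
rewrite -(mulmxA _ _ (signature_mx _ _ _)) signature_mx_sqr mulmx1.
by rewrite -invmx_unitary ?mulVmx ?unitarymx_unit.
Qed.

Theorem theorem2p2 (R : realType) (m1 m2 n : nat) (L : option nat)
    (U : nat -> 'M[R[i]]_(m1 + m2))
    (alpha S0 : 'M[R[i]]_n) (Lambda0 : 'M[R[i]]_(n, m1 + m2)) :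
  let C := dirac_potential U in
  let S := S_ C alpha S0 Lambda0 in
  let tC := transformed_potential C alpha S0 Lambda0 in
  let w := fundamental_solution C in
  let tw := fundamental_solution tC in
  let w_alpha := darboux_mx C alpha S0 Lambda0 in
  (0 < m1)%N -> (0 < m2)%N -> (0 < n)%N -> valid_length L ->
  (forall k, system_index L k -> U k \is unitarymx) ->
  S0 = S0^t* ->
  alpha *m S0 - S0 *m alpha^t* = 'i *: (Lambda0 *m Lambda0^t*) ->
  \det alpha != 0 ->
  (forall k, solution_index L k -> \det (S k) != 0) ->
  forall (k : nat) (z : R[i]),
    solution_index L k ->
    z != 0 -> ~~ eigenvalue alpha (- z) -> w_alpha 0%N (- z) \in unitmx ->
    tw k z = w_alpha k (- z) *m w k z *m invmx (w_alpha 0%N (- z)).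
Proof.
move=> C S tC w tw w_alpha _ _ _ _ hU _ hS0 da dS k z hk z0 hz uw0.
have unitE p (A : 'M[R[i]]_p) : (A \in unitmx) = (\det A != 0).
  by rewrite unitmxE unitfE.
have ua : alpha \in unitmx by rewrite unitE.
(* The eigenspace at [- z] is the kernel of [alpha + z%:M], and a square matrix with zero kernel is
   invertible. *)
have uz : alpha + z%:M \in unitmx.
  move: hz; rewrite /eigenvalue /eigenspace kermx_eq0 row_free_unit.
  by rewrite negbK raddfN opprK.
rewrite -(fundamental_solution_darboux ua _ hS0 _ z0 uz) ?mulmxK //.
  (* On a finite interval [k] may equal [N], but only potentials with [i < k] occur, so [i] is a
     system index. *)
  move=> i ik; have uU : U i \is unitarymx.
    by apply: hU; move: hk; case: (L) => //= N; apply: leq_trans.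
  by split; [apply: dirac_potential_adj | apply: dirac_potential_sqr].
move=> i ik; rewrite unitE; apply: dS.
by move: hk; case: (L) => //= N; apply: leq_trans.
Qed.
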